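(* There is an absolute constant $C$ such that for any metric space $M=(V,d)$ on $|V|=n$ points, any $\beta>1$, any $k>1$ and any $1<\ell\le k$, there exists a subset $S\subseteq V$ such that $|S|\ge n^{\frac{1}{2\beta\lceil\log_\ell k\rceil}}$ and $(S,d)$ $O(\ell\log_\beta\log n)$-approximates some binary/balanced $k$-HST (the $O(\cdot)$ hiding the absolute constant $C$).
   Context: A metric space $(X,d)$ $\alpha$-approximates $(X,d')$ if $d'(u,v)\le d(u,v)\le\alpha d'(u,v)$ for all $u,v$. For $k\ge1$, a $k$-HST is a metric space on the leaves of a rooted tree $T$ with vertex labels $\Delta(u)\ge0$, $\Delta(u)=0$ iff $u$ is a leaf, $\Delta(u)\le\Delta(v)/k$ whenever $u$ is a child of $v$, and distance between leaves $x,y$ equal to $\Delta(\mathrm{lca}(x,y))$. A vertex $u$ of a rooted tree is balanced if the numbers of leaves of any two subtrees rooted at children of $u$ differ by at most one. A binary/balanced $k$-HST is a $k$-HST in which every internal vertex of the underlying tree is either balanced or has at most two children.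
   Formalization: The approximation factor is read as max(1, C ℓ log_β log n) with log to base 2 and n ≥ 1, since the literal factor can fall below 1 (it is 0 for n = 2) while the size bound forces |S| ≥ 2, which makes the literal claim false. *)

(* Defs.v *)
From HB Require Import structures.
From mathcomp Require Import all_boot all_order all_algebra.
From mathcomp Require Import all_classical all_reals all_analysis.

Set Implicit Arguments.
Unset Strict Implicit.
Unset Printing Implicit Defensive.

Import Order.TTheory GRing.Theory Num.Theory.

Local Open Scope ring_scope.

#[short(type="finMetricType")]
HB.structure Definition FinMetric (K : numDomainType) :=
  { M of Finite M & Metric K M }.

Definition logb (R : realType) (b x : R) : R := ln x / ln b.

(* Rooted trees with labelled vertices whose leaves are named by points of V.
   A vertex is identified with the subtree rooted at it. *)
Inductive ltree (R V : Type) : Type :=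
| Leaf of V
| Node of R & seq (ltree R V).

Arguments Leaf {R V}.
Arguments Node {R V}.

Fixpoint leaves (R V : Type) (t : ltree R V) : seq V :=
  match t with
  | Leaf x => [:: x]
  | Node _ cs => flatten [seq leaves c | c <- cs]
  end.

(* The vertex label Delta; leaves have label 0 by construction. *)
Definition label (R : realType) (V : Type) (t : ltree R V) : R :=
  if t is Node D _ then D else 0.

(* For two leaves x and y of t: if some child of the root is an ancestor of
   both, the lowest common ancestor is searched in that child (it is unique
   when the leaves of t are distinct); otherwise it is the root. *)
Fixpoint lca (R : Type) (V : eqType) (t : ltree R V) (x y : V) : ltree R V :=
  match t with
  | Leaf _ => t
  | Node _ cs =>
      foldr (fun c u =>
               if (x \in leaves c) && (y \in leaves c) then lca c x y else u)
            t cs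
  end.

(* The conditions on the labels of a k-HST. A [Node] must have a child, so that
   the leaves of the tree are exactly the [Leaf] vertices; together with
   0 < D this says that a label is nonnegative and vanishes exactly at leaves. *)
Fixpoint hst_labels (R : realType) (V : Type) (k : R) (t : ltree R V) : bool :=
  match t with
  | Leaf _ => true
  | Node D cs =>
      [&& (0 < size cs)%N, 0 < D,
          all (fun c => label c <= D / k) cs & all (hst_labels k) cs]
  end.

(* The condition "balanced" on a vertex with children cs. *)
Definition balanced_children (R V : Type) (cs : seq (ltree R V)) : bool :=
  all2rel (fun a b => size (leaves a) <= (size (leaves b)).+1)%N cs.

Fixpoint binary_balanced (R V : Type) (t : ltree R V) : bool :=
  match t with
  | Leaf _ => true
  | Node _ cs =>
      (balanced_children cs || (size cs <= 2)%N) && all (@binary_balanced R V) cs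
  end.

(* t is the underlying labelled tree of a k-HST with point set S and
   distance d. *)
Definition hst_tree (R : realType) (V : finType) (k : R) (S : {set V})
    (d : V -> V -> R) (t : ltree R V) : Prop :=
  [/\ hst_labels k t, uniq (leaves t), leaves t =i S
    & {in S &, forall x y, d x y = label (lca t x y)}].

Definition binary_balanced_hst (R : realType) (V : finType) (k : R)
    (S : {set V}) (d : V -> V -> R) : Prop :=
  exists t : ltree R V, hst_tree k S d t /\ binary_balanced t.

(* (S, d) alpha-approximates (S, d'). *)
Definition approximates (R : realType) (V : finType) (S : {set V}) (alpha : R)
    (d d' : V -> V -> R) : Prop :=
  {in S &, forall u v, d' u v <= d u v <= alpha * d' u v}.

(* The approximation factor "C l log_beta (log n)". It is cut off below at 1:
   a factor below 1 is impossible as soon as S has two points, while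
   log_beta (log n) tends to 0 as beta grows and is meaningless for n = 1. *)
Definition approx_factor (R : realType) (C beta l : R) (n : nat) : R :=
  Num.max 1 (C * l * logb beta (logb 2 n%:R)).

(* Main.v *)
Require Import Defs.
From HB Require Import structures.
From mathcomp Require Import all_boot all_order all_algebra.
From mathcomp Require Import all_classical all_reals all_analysis.
From mathcomp Require Import zify ring lra.

Set Implicit Arguments.
Unset Strict Implicit.
Unset Printing Implicit Defensive.

Import Order.TTheory GRing.Theory Num.Theory.

Local Open Scope ring_scope.

(* Let D be the distance of two points of A and m >= log_beta log |A|. A ball of
   radius D/4 around one of them contains at most half of A, so among the radii
   i D / 4m (i < m) some consecutive pair r < r' satisfies
   |B(r)|^(1/beta) + |A \ B(r')|^(1/beta) >= |A|^(1/beta): otherwise the density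
   p_i = |B(i D / 4m)|/|A| would satisfy p_i < p_(i+1)^beta for all i, hence
   p_0 < 2^-(beta^m) <= 1/|A|. Recursing on B(r) and A \ B(r'), with D the
   diameter, would give a binary tree; to get ratio k between labels, round
   labels down to powers of l and build c = ceil(log_l k) trees at once, the tree
   of index j branching only where the exponent is j mod c and keeping the larger
   subtree elsewhere. The product of the c leaf counts is superadditive, so some
   tree has at least |M|^(1/(beta c)) leaves. Finally a k-HST with N leaves has a
   binary/balanced subtree with at least sqrt N leaves. If the required size is at
   most 2, two points suffice; otherwise log_beta log n > 1, which absorbs the
   rounding of m. *)

(** * Sums of squares bounded by counting *)

(* Write a ^ 2 as the sum of 2 v - 1 over 1 <= v <= a and exchange the sums. *)
Lemma sum_sqr_count (s : seq nat) (q m : nat) :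
  all (fun a => a <= q)%N s ->
  (forall v, v <= q -> v * count (leq v) s <= m)%N ->
  (\sum_(a <- s) a ^ 2 <= 2 * m * q)%N.
Proof.
move=> sq sm.
have sqrE a : (a <= q -> a ^ 2 = \sum_(1 <= v < q.+1 | v <= a) (2 * v - 1))%N.
  move=> aq; transitivity (\sum_(1 <= v < a.+1) (2 * v - 1))%N.
    elim: a {aq} => [|a IH]; first by rewrite big_geq.
    by rewrite big_nat_recr //= -IH; nia.
  by rewrite (@big_nat_widen _ _ _ 1%N a.+1 q.+1).
rewrite big_seq (eq_bigr (fun a => \sum_(1 <= v < q.+1 | v <= a) (2 * v - 1)))%N;
  last by move=> a /(allP sq) /sqrE.
rewrite -big_seq (exchange_big_dep predT) //=.
apply: (@leq_trans (\sum_(1 <= v < q.+1) (2 * m))%N); last first.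
  by rewrite sum_nat_const_nat subn1 mulnC.
rewrite big_nat [leqRHS]big_nat; apply: leq_sum => v /andP[_ vq].
by rewrite big_const_seq iter_addn_0; have := sm v vq; nia.
Qed.

Lemma split_max (T : Type) (f : T -> nat) (s : seq T) : (0 < size s)%N ->
  exists s1 p s2, s = s1 ++ p :: s2 /\ all (fun a => f a <= f p)%N s.
Proof.
elim: s => // a [_ _|b s IH _]; first by exists [::], a, [::]; rewrite /= leqnn.
have [//|s1 [p [s2 [-> sp]]]] := IH; have [ap|pa] := leqP (f a) (f p).
  by exists (a :: s1), p, s2; rewrite /= ap.
exists [::], a, (s1 ++ p :: s2); split=> //=; rewrite leqnn /=.
by apply: sub_all sp => x /leq_trans; apply; apply: ltnW.
Qed.

(* Split off the largest element p and let q bound the others, with p + q <= m.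
   Adding a copy of q to the others does not increase the counts at levels
   v <= q, so their squares and q ^ 2 add up to at most 2 m q. *)
Lemma sum_sqr_le (s : seq nat) (m : nat) :
  pairwise (fun a b => a + b <= m)%N s ->
  (forall v, v * count (leq v) s <= m)%N ->
  (\sum_(a <- s) a ^ 2 <= m ^ 2)%N.
Proof.
case: (posnP (size s)) => [/size0nil -> _ _|s_gt0]; first by rewrite big_nil.
have [s1 [p [s2 [-> +]]]] := split_max id s_gt0.
rewrite all_cat /= => /and3P[s1p _ s2p].
rewrite pairwise_cat allrel_consr pairwise_cons.
move=> /and4P[/andP[s1m _] _ s2m _] sm.
have pm : (p <= m)%N by have := sm p; rewrite count_cat /= leqnn; nia.
pose q := minn p (m - p).
have /(@sum_sqr_count (q :: s1 ++ s2) q) : all (fun a => a <= q)%N (q :: s1 ++ s2).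
  rewrite /= leqnn all_cat /=; apply/andP; split.
    by apply/allP => a as1; move: (allP s1m _ as1) (allP s1p _ as1) => /=; lia.
  by apply/allP => a as2; move: (allP s2m _ as2) (allP s2p _ as2) => /=; lia.
move=> /(_ m) H.
have {}H : (\sum_(a <- q :: s1 ++ s2) a ^ 2 <= 2 * m * q)%N.
  apply: H => v vq; apply: leq_trans (sm v).
  have vp : (v <= p)%N by lia.
  by rewrite /= !count_cat /= vq vp addnCA.
move: H; rewrite big_cons !big_cat big_cons /=.
by move: (\sum_(i <- s1) _)%N (\sum_(i <- s2) _)%N => x y; nia.
Qed.

(** * Labelled trees approximating the metric, and their pruning *)

(** By maximality the other entries are at most [q.+1], so after the decrease none exceeds [q] by
    more than one. This keeps a balanced vertex balanced in [remove_leaf]. *)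
Lemma all2rel_decr_max (n1 n2 : seq nat) (q : nat) :
  all2rel (fun a b => a <= b.+1)%N (n1 ++ q.+1 :: n2) ->
  all (fun a => a <= q.+1)%N (n1 ++ q.+1 :: n2) ->
  all2rel (fun a b => a <= b.+1)%N (n1 ++ q :: n2).
Proof.
move=> /allrelP B /allP A; apply/allrelP => x y.
have mem z : z \in n1 ++ q :: n2 -> z = q \/ z \in n1 ++ q.+1 :: n2.
  rewrite !mem_cat !inE => /or3P[->|/eqP|->]; by [right|left|right; rewrite !orbT].
have qmem : q.+1 \in n1 ++ q.+1 :: n2 by rewrite mem_cat inE eqxx orbT.
move=> /mem[->|xn] /mem[->|yn]; [lia | | exact: A | exact: B].
by apply: leqW; rewrite -ltnS; apply: B.
Qed.

(** The inner induction over [cs] supplies the hypotheses for the children, which are nested inside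
    a [seq]. *)
Lemma ltree_nested_ind (R V : Type) (P : ltree R V -> Prop) :
  (forall x, P (Leaf x)) ->
  (forall D cs, List.Forall P cs -> P (Node D cs)) ->
  forall t, P t.
Proof.
move=> PL PN; fix IH 1 => -[x|D cs]; first exact: PL.
apply: PN; elim: cs => [|c cs IHcs]; constructor; [exact: IH | exact: IHcs].
Qed.

Section Trees.
Context (R : realType) (M : finMetricType R) (k alpha : R).
Local Notation tree := (ltree R M).
Implicit Types (t u c : tree) (cs : seq tree) (D : R).

Definition apart D (c c' : tree) : bool :=
  allrel (fun x y => D <= mdist x y <= alpha * D) (leaves c) (leaves c').

(** The approximation condition is kept local to each vertex, with no mention of [lca], so that
    pruning preserves it by mere inclusion of leaf sets; [lca_bounds] recovers the global form. *)
Fixpoint separated t : bool :=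
  match t with
  | Leaf _ => true
  | Node D cs => pairwise (apart D) cs && all separated cs
  end.

Definition good t : bool := hst_labels k t && separated t.

Lemma good_node D cs : good (Node D cs) =
  [&& (0 < size cs)%N, 0 < D, all (fun c => label c <= D / k) cs,
      pairwise (apart D) cs & all good cs].
Proof.
have -> : all good cs = all (hst_labels k) cs && all separated cs.
  by rewrite -all_predI; apply: eq_all.
by rewrite /good /= -!andbA; congr [&& _, _, _ & _]; exact: andbCA.
Qed.

Lemma leaves_node D cs : leaves (Node D cs) = flatten [seq leaves c | c <- cs].
Proof. by []. Qed.

Lemma size_flatten_leaves cs :
  size (flatten [seq leaves c | c <- cs]) = (\sum_(c <- cs) size (leaves c))%N.
Proof. by rewrite size_flatten sumnE /shape !big_map. Qed.

Lemma size_leaves_gt0 t : good t -> (0 < size (leaves t))%N.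
Proof.
elim/ltree_nested_ind: t => // D [|c cs] IH; rewrite good_node //=.
move=> /and4P[_ _ _ /andP[gc _]]; inversion IH; subst.
by rewrite size_cat addn_gt0 H1.
Qed.

Lemma apart_flatten D c cs x y : all (apart D c) cs -> x \in leaves c ->
  y \in flatten [seq leaves c' | c' <- cs] -> D <= mdist x y <= alpha * D.
Proof.
move=> + xc; elim: cs => //= c' cs IH /andP[acc' acs].
by rewrite mem_cat => /orP[yc'|]; [exact: (allrelP acc') | exact: IH].
Qed.

(** A leaf shared by two children would be at distance 0 from itself, below the positive label of
    their parent. *)
Lemma good_uniq t : good t -> uniq (leaves t).
Proof.
elim/ltree_nested_ind: t => // D cs IH; rewrite good_node.
move=> /and5P[_ D0 _ + +]; rewrite leaves_node.
elim: IH => //= c {}cs IHc _ IHcs /andP[ac acs] /andP[gc gcs].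
rewrite cat_uniq IHc // IHcs // andbT /=; apply/hasPn => x xcs.
by apply/negP => xc; have := apart_flatten ac xc xcs; rewrite mdistxx leNgt D0.
Qed.

Lemma apart_sub D c1 c2 c1' c2' :
  {subset leaves c1' <= leaves c1} -> {subset leaves c2' <= leaves c2} ->
  apart D c1 c2 -> apart D c1' c2'.
Proof.
move=> s1 s2 /allrelP a12; apply/allrelP => x y /s1 xc1 /s2 yc2; exact: a12.
Qed.

(** Labels may not grow, so that [t'] can take the place of [t] below a parent with the factor [k]
    intact. *)
Definition refines t' t : Prop :=
  [/\ good t', {subset leaves t' <= leaves t} & label t' <= label t].

Lemma refines_refl t : good t -> refines t t.
Proof. by move=> gt; split. Qed.

Lemma refines_trans t1 t2 t3 : refines t1 t2 -> refines t2 t3 -> refines t1 t3.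
Proof.
move=> [g1 s1 l1] [_ s2 l2]; split=> //; first by move=> x /s1 /s2.
exact: le_trans l2.
Qed.

(** Some children are deleted and the others refined, in order, so that pairwise conditions on the
    list survive. *)
Inductive pruned : seq tree -> seq tree -> Prop :=
| pruned_nil : pruned [::] [::]
| pruned_skip c cs cs' : pruned cs cs' -> pruned (c :: cs) cs'
| pruned_keep c c' cs cs' : refines c' c -> pruned cs cs' ->
    pruned (c :: cs) (c' :: cs').

Lemma pruned_trans cs1 cs2 cs3 : pruned cs1 cs2 -> pruned cs2 cs3 -> pruned cs1 cs3.
Proof.
move=> p12; elim: p12 cs3 => [//|c cs cs' _ IH|c c' cs cs' r _ IH] cs3 p23.
  by constructor; apply: IH.
inversion p23; subst; first by constructor; apply: IH.
by apply: pruned_keep; [apply: refines_trans r | apply: IH].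
Qed.

Lemma pruned_refl cs : all good cs -> pruned cs cs.
Proof. elim: cs => [_|c cs IH /= /andP[gc gcs]]; first exact: pruned_nil.
by apply: pruned_keep; [exact: refines_refl | exact: IH]. Qed.

Lemma pruned_cat cs1 cs1' cs2 cs2' :
  pruned cs1 cs1' -> pruned cs2 cs2' -> pruned (cs1 ++ cs2) (cs1' ++ cs2').
Proof. by move=> p1 p2; elim: p1 => //= *; constructor. Qed.

Lemma pruned_none cs : pruned cs [::].
Proof. by elim: cs => [|c cs IH]; [exact: pruned_nil | exact: pruned_skip]. Qed.

(** Any two children form a pruning: delete all others. This provides the pairwise hypothesis of
    [sum_sqr_le]. *)
Lemma pruned_pairwise (P : pred tree) (r : rel tree) cs :
  all good cs -> all P cs ->
  (forall a b, P a -> P b -> pruned cs [:: a; b] -> r a b) -> pairwise r cs.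
Proof.
elim: cs => //= c cs IH /andP[gc gcs] /andP[Pc Pcs] H; rewrite IH // ?andbT; last first.
  by move=> a b Pa Pb p; apply: H => //; apply: pruned_skip.
have {}H b : P b -> pruned cs [:: b] -> r c b.
  by move=> Pb p; apply: H => //; apply: pruned_keep => //; exact: refines_refl.
elim: cs gcs Pcs H {IH} => //= b cs IH /andP[gb gcs] /andP[Pb Pcs] H.
rewrite H //=; last by apply: pruned_keep; [apply: refines_refl | apply: pruned_none].
by apply: IH => // b' Pb' p; apply: H => //; apply: pruned_skip.
Qed.

Lemma pruned_subset cs cs' D : pruned cs cs' ->
  {subset leaves (Node D cs') <= leaves (Node D cs)}.
Proof.
rewrite !leaves_node.
elim=> // [c {}cs {}cs' _ IH x /IH|c c' {}cs {}cs' [_ sc _] _ IH x] /=.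
  by rewrite mem_cat orbC => ->.
by rewrite !mem_cat => /orP[/sc ->//|/IH ->]; rewrite orbT.
Qed.

Lemma pruned_good cs cs' D : good (Node D cs) -> pruned cs cs' ->
  (0 < size cs')%N -> refines (Node D cs') (Node D cs).
Proof.
move=> gN p s0; split=> //; last exact: pruned_subset.
move: gN; rewrite !good_node s0 => /and5P[_ D0 + + +] /=; rewrite D0 /=.
elim: p {s0} => //= [c {}cs {}cs' _ IH|c c' {}cs {}cs' [gc sc lc] p IH].
  by move=> /andP[_ +] /andP[_ +] /andP[_ +]; exact: IH.
move=> /andP[lcD lcs] /andP[ac acs] /andP[_ gcs]; rewrite gc (le_trans lc) //=.
have /and3P[-> -> ->] := IH lcs acs gcs; rewrite !andbT.
elim: p ac {IH lcs acs gcs} => //= [b {}cs {}cs' _ IH|b b' {}cs {}cs' [_ sb _] p IH].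
  by move=> /andP[_]; exact: IH.
by move=> /andP[ab acs]; rewrite IH // andbT; apply: apart_sub ab.
Qed.

Lemma balanced_childrenE cs : balanced_children cs =
  all2rel (fun a b => a <= b.+1)%N [seq size (leaves c) | c <- cs].
Proof. by rewrite /balanced_children allrel_mapl allrel_mapr. Qed.

Lemma binary_balanced_node D cs : binary_balanced (Node D cs) =
  (balanced_children cs || (size cs <= 2)%N) && all (@binary_balanced R M) cs.
Proof. by []. Qed.

(* A leaf is removed from a child with the most leaves, so that a balanced vertex
   stays balanced. *)
Lemma remove_leaf t : good t -> binary_balanced t -> (1 < size (leaves t))%N ->
  exists t', [/\ refines t' t, binary_balanced t' &
                 (size (leaves t')).+1 = size (leaves t)].
Proof.
elim/ltree_nested_ind: t => // D cs IH gN; rewrite binary_balanced_node.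
move=> /andP[bN bcs] s1; move: (gN); rewrite good_node => /and5P[cs0 _ _ _ gcs].
have [cs1 [p [cs2 [Ecs maxp]]]] := split_max (fun c => size (leaves c)) cs0.
subst cs; move: gcs bcs; rewrite !all_cat /=.
move=> /and3P[gcs1 gp gcs2] /and3P[bcs1 bp bcs2].
(* A largest child with a single leaf is dropped altogether; another child remains because the tree
   has at least two leaves. *)
have [sp|sp] := leqP (size (leaves p)) 1.
  have sp1 : size (leaves p) = 1%N by apply/eqP; rewrite eqn_leq sp size_leaves_gt0.
  have pr : pruned (cs1 ++ p :: cs2) (cs1 ++ cs2).
    by apply: pruned_cat; [|apply: pruned_skip]; apply: pruned_refl.
  exists (Node D (cs1 ++ cs2)); split.
  - apply: pruned_good => //.
    move: s1; rewrite /= size_flatten_leaves big_cat big_cons /= sp1 addnCA -big_cat /=.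
    by case: (cs1 ++ cs2) => //; rewrite big_nil.
  - rewrite binary_balanced_node all_cat bcs1 bcs2 !andbT.
    case/orP: bN => [|s2]; last first.
      by apply/orP; right; move: s2; rewrite !size_cat /= addnS; exact: ltnW.
    rewrite /balanced_children !allrel_catl !allrel_catr !allrel_consl !allrel_consr.
    by do !case: (allrel _ _ _); rewrite ?andbF.
  - by rewrite /= !size_flatten_leaves !big_cat /= big_cons sp1 addnS.
have [p' [rp bp' sp']] : exists t', [/\ refines t' p, binary_balanced t' &
                 (size (leaves t')).+1 = size (leaves p)].
  by have := proj1 (List.Forall_forall _ _) IH p; apply=> //; apply: List.in_elt.
have pr : pruned (cs1 ++ p :: cs2) (cs1 ++ p' :: cs2).
  by apply: pruned_cat; [|apply: pruned_keep => //]; apply: pruned_refl.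
exists (Node D (cs1 ++ p' :: cs2)); split.
- by apply: pruned_good => //; rewrite size_cat /= addnS.
- rewrite binary_balanced_node all_cat /= bcs1 bcs2 bp' !andbT.
  case/orP: bN => [|s2]; last first.
    by apply/orP; right; move: s2; rewrite !size_cat /= addnS; done.
  move=> bN; apply/orP; left; move: bN maxp.
  rewrite !balanced_childrenE -(all_map _ (fun a => a <= size (leaves p))%N) !map_cat /=.
  by rewrite -sp'; apply: all2rel_decr_max.
- rewrite /= !size_flatten_leaves !big_cat /= !big_cons -sp'.
  by rewrite addSn addnS.
Qed.

Lemma trim t (v : nat) : good t -> binary_balanced t ->
  (0 < v <= size (leaves t))%N ->
  exists t', [/\ refines t' t, binary_balanced t' & size (leaves t') = v].
Proof.
have [n] := ubnP (size (leaves t) - v)%N.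
elim: n t => // n IH t ltn gt bt /andP[v0].
rewrite leq_eqVlt => /orP[/eqP->|vt].
  by exists t; split=> //; apply: refines_refl.
have [|u [ut bu su]] := remove_leaf gt bt; first exact: leq_ltn_trans vt.
have [||||t' [t'u bt' st']] := IH u; rewrite ?v0 //.
- by move: ltn; rewrite -su subSn // -ltnS su.
- by case: ut.
- by rewrite -ltnS su.
by exists t'; split=> //; apply: refines_trans ut.
Qed.

(** Children trimmed to exactly [v] leaves form a balanced vertex, whatever their number. This
    provides the counting hypothesis of [sum_sqr_le]. *)
Lemma trim_children cs (v : nat) :
  all good cs -> all (@binary_balanced R M) cs -> (0 < v)%N ->
  exists ts, [/\ pruned cs ts, all (@binary_balanced R M) ts,
    all (fun c => size (leaves c) == v) ts &
    size ts = count (leq v) [seq size (leaves c) | c <- cs]].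
Proof.
move=> gcs bcs v0; elim: cs gcs bcs => [_ _|c cs IH /= /andP[gc gcs] /andP[bc bcs]].
  by exists [::]; split=> //; apply: pruned_nil.
have [ts [pts bts sts nts]] := IH gcs bcs; have [vc|cv] := leqP v (size (leaves c)).
  have [|c' [rc' bc' /eqP sc']] := @trim c v gc bc; first by rewrite v0.
  exists (c' :: ts); rewrite /= bc' sc' nts; split=> //; exact: pruned_keep.
by exists ts; split=> //; apply: pruned_skip.
Qed.

(* By induction each child c has a subtree of g c leaves, where g c ^ 2 bounds its
   size. If no admissible subtree has more than m leaves, then g a + g b <= m for
   two children (keep just these), and v * #{c | v <= g c} <= m (trim these to
   exactly v leaves), so that sum_sqr_le applies. *)
Lemma prune_binary_balanced t : good t ->
  exists t', [/\ refines t' t, binary_balanced t' &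
                 size (leaves t) <= size (leaves t') ^ 2]%N.
Proof.
elim/ltree_nested_ind: t => [x _|D cs IH gN].
  by exists (Leaf x); split=> //; apply: refines_refl.
have [cs' [pcs gcs' bcs' ss' lecs]] : exists cs', [/\ pruned cs cs', all good cs',
    all (@binary_balanced R M) cs', size cs' = size cs &
    \sum_(c <- cs) size (leaves c) <= \sum_(c <- cs') size (leaves c) ^ 2]%N.
  move: gN; rewrite good_node => /and5P[_ _ _ _].
  elim: {cs}IH => [_|c cs IHc _ IH /= /andP[gc gcs]].
    by exists [::]; rewrite !big_nil; split=> //; apply: pruned_nil.
  have [c' [rc' bc' sc']] := IHc gc; have [cs' [pcs' gcs' bcs' ss lecs]] := IH gcs.
  exists (c' :: cs'); rewrite /= bc' gcs' ss !big_cons; split=> //.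
  - exact: pruned_keep.
  - by case: rc' => ->.
  - exact: leq_add.
have cs0 : (0 < size cs)%N by move: gN; rewrite good_node => /andP[].
apply: contrapT => /forallNP small.
set N := size (leaves (Node D cs)) in small.
have N0 : (0 < N)%N by apply: size_leaves_gt0.
(* With this [m], any admissible subtree with more than [m] leaves has a square of at least [N] and
   contradicts [small]. *)
have [m /andP[mN Nm]] : exists m, (m ^ 2 < N <= m.+1 ^ 2)%N.
  elim: (N) N0 => // -[_ _|n IHn _]; first by exists 0%N.
  have [//|m /andP[mn nm]] := IHn; have [le|lt] := leqP n.+2 (m.+1 ^ 2).
    by exists m; rewrite le andbT ltnW.
  by exists m.+1; rewrite lt /=; apply: leq_ltn_trans nm _; rewrite ltn_exp2r.
have le_m ts : pruned cs' ts -> (0 < size ts)%N ->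
    all (@binary_balanced R M) ts -> balanced_children ts || (size ts <= 2)%N ->
    (\sum_(c <- ts) size (leaves c) <= m)%N.
  move=> pts ts0 bts B; rewrite -size_flatten_leaves leqNgt; apply/negP => mts.
  apply: (small (Node D ts)); split.
  - by apply: pruned_good => //; apply: pruned_trans pts.
  - by rewrite binary_balanced_node B.
  - by apply: leq_trans Nm _; rewrite leq_exp2r.
have : (\sum_(a <- [seq size (leaves c) | c <- cs']) a ^ 2 <= m ^ 2)%N.
  apply: sum_sqr_le.
    rewrite pairwise_map; apply: (pruned_pairwise gcs' bcs') => a b ba bb pab.
    have := @le_m [:: a; b] pab isT; rewrite /= ba bb orbT big_cons big_seq1.
    exact.
  move=> v; have [->|v0] := posnP v; first by rewrite mul0n.
  have [ts [pts bts sts <-]] := trim_children gcs' bcs' v0.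
  have [->|ts0] := posnP (size ts); first by rewrite muln0.
  have vE : map (fun c => size (leaves c)) ts = nseq (size ts) v.
    by elim: ts sts {pts bts ts0} => //= c ts IHts /andP[/eqP-> /IHts ->].
  have := le_m ts pts ts0 bts; rewrite -(big_map _ xpredT id) vE.
  rewrite big_nseq iter_addn_0; apply; apply/orP; left.
  rewrite balanced_childrenE vE; apply/allrelP => x y.
  by rewrite !mem_nseq => /andP[_ /eqP->] /andP[_ /eqP->].
rewrite big_map => le2; have : (N <= m ^ 2)%N.
  by apply: leq_trans le2; rewrite /N /= size_flatten_leaves.
by rewrite leqNgt mN.
Qed.

Lemma foldr_lca_default cs u x y :
  ~~ ((x \in flatten [seq leaves c | c <- cs]) &&
      (y \in flatten [seq leaves c | c <- cs])) ->
  foldr (fun c w => if (x \in leaves c) && (y \in leaves c) then lca c x y else w)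
    u cs = u.
Proof.
elim: cs => //= c cs IH; rewrite !mem_cat => H.
case: ifP => [/andP[xc yc]|_]; first by rewrite xc yc in H.
by apply: IH; apply: contra H => /andP[-> ->]; rewrite !orbT.
Qed.

(** If one child contains both points, induction applies. Otherwise they lie in different children,
    [lca] falls through to the root, and [apart] bounds their distance. *)
Lemma lca_bounds t : good t -> {in leaves t &, forall x y,
  label (lca t x y) <= mdist x y <= alpha * label (lca t x y)}.
Proof.
elim/ltree_nested_ind: t => [v _ x y|D cs IH gN].
  by rewrite !inE => /eqP-> /eqP->; rewrite mdistxx mulr0 lexx.
have := good_uniq gN; move: gN; rewrite good_node => /and5P[_ _ _ + +].
rewrite leaves_node => acs gcs ucs x y /=.
(* The root becomes an arbitrary [u] of label [D], so that the induction can shorten the list of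
   children while the default value of the [foldr] stays fixed. *)
have : label (Node D cs) = D by []; move: (Node D cs) => u labu.
elim: cs IH acs gcs ucs => //= c cs IHcs /List.Forall_cons_iff[IHc IH].
move=> /andP[ac acs] /andP[gc gcs]; rewrite cat_uniq => /and3P[_ nc ucs].
rewrite !mem_cat; case: ifP => [/andP[xc yc] _ _|nxy]; first exact: IHc.
have excl z : z \in leaves c -> z \notin flatten [seq leaves c | c <- cs].
  by move=> zc; apply/negP => zcs; move/hasPn/(_ z zcs): nc; rewrite zc.
move=> /orP[xc|xcs] /orP[yc|ycs]; first by rewrite xc yc in nxy.
- by rewrite foldr_lca_default ?labu ?(negPf (excl x xc)) //; apply: apart_flatten ac xc ycs.
- rewrite foldr_lca_default ?labu ?(negPf (excl y yc)) ?andbF // metric_sym.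
  exact: apart_flatten ac yc xcs.
- exact: IHcs.
Qed.
End Trees.

(** * Splitting a finite metric space into two distant parts *)

(** Put p = b / N. As 1 / beta < 1 and 1 - p lies in [0, 1], (1 - p)^(1/beta) is at least 1 - p,
    which leaves (a / N)^(1/beta) < p. *)
Lemma powR_split (R : realType) (beta N a b : R) : 1 < beta -> 0 < N ->
  0 <= a -> 0 <= b <= N ->
  a `^ beta^-1 + (N - b) `^ beta^-1 < N `^ beta^-1 ->
  a / N < (b / N) `^ beta.
Proof.
move=> beta1 N0 a0 /andP[b0 bN] H.
have beta0 : 0 < beta by lra.
have scale x : 0 <= x -> x `^ beta^-1 = N `^ beta^-1 * (x / N) `^ beta^-1.
  move=> x0; rewrite -powRM ?divr_ge0 // ?ltW //.
  by rewrite mulrC divfK ?gt_eqF.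
have Ng : 0 < N `^ beta^-1 by apply: powR_gt0.
have {}H : (a / N) `^ beta^-1 < b / N.
  move: H; rewrite (scale a) // (scale (N - b)) ?subr_ge0 // -mulrDr.
  rewrite -{2}[N `^ _]mulr1 ltr_pM2l // => H.
  have : (N - b) / N <= ((N - b) / N) `^ beta^-1.
    have [->|Nb] := eqVneq b N.
      by rewrite subrr mul0r powR0 // invr_eq0 gt_eqF.
    apply: ger1_powR.
      have Nb0 : 0 < N - b by rewrite subr_gt0 lt_neqAle Nb.
      by rewrite (divr_gt0 Nb0 N0) /= ler_pdivrMr // mul1r gerBl.
    by rewrite invf_le1 // ltW.
  by move: H; rewrite mulrBl divff ?gt_eqF //; lra.
have -> : a / N = ((a / N) `^ beta^-1) `^ beta.
  by rewrite -powRrM mulVf ?gt_eqF // powRr1 // divr_ge0 // ltW.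
by apply: gt0_ltr_powR => //; rewrite nnegrE ?powR_ge0 // divr_ge0 // ltW.
Qed.

Section Split.
Context (R : realType) (M : finMetricType R).
Implicit Types (A : {set M}) (x y : M).

(** By the triangle inequality the balls around [x0] and [y0] are disjoint, so the smaller one holds
    at most half of [A]. *)
Lemma small_ball A x0 y0 : x0 \in A -> y0 \in A -> x0 != y0 ->
  exists2 x, x \in A &
    (2 * #|[set z in A | (mdist x z <= mdist x0 y0 / 4)%R]| <= #|A|)%N.
Proof.
move=> x0A y0A xy; have D0 : 0 < mdist x0 y0 by rewrite mdist_gt0.
pose B x := [set z in A | mdist x z <= mdist x0 y0 / 4].
have disj : [disjoint B x0 & B y0].
  rewrite finset.disjoints_subset; apply/fintype.subsetP => z; rewrite !inE => /andP[-> xz] /=.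
  rewrite -ltNge; have := metric_triangle x0 z y0.
  by rewrite (metric_sym z y0); lra.
have : (#|B x0| + #|B y0| <= #|A|)%N.
  have := leq_card_setU (B x0) (B y0); rewrite disj => -[_ /eqP <-].
  by apply: subset_leq_card; apply/fintype.subsetP => z; rewrite !inE => /orP[]/andP[].
have [le h|lt h] := leqP #|B x0| #|B y0|.
  by exists x0 => //; rewrite -/(B x0); move: le h; clear; lia.
by exists y0 => //; rewrite -/(B y0); move: lt h; clear; lia.
Qed.

Lemma split_set A x0 y0 (beta : R) (m : nat) :
  x0 \in A -> y0 \in A -> x0 != y0 -> 1 < beta -> (0 < m)%N ->
  #|A|%:R <= 2 `^ (beta ^+ m) ->
  exists I O : {set M}, [/\ I \subset A, O \subset A, (0 < #|I|)%N, (0 < #|O|)%N &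
    (forall x y, x \in I -> y \in O -> mdist x0 y0 / (4 * m%:R) <= mdist x y) /\
    #|A|%:R `^ beta^-1 <= #|I|%:R `^ beta^-1 + #|O|%:R `^ beta^-1 ].
Proof.
move=> x0A y0A xy beta1 m0 Am.
have beta0 : 0 < beta by lra.
have D0 : 0 < mdist x0 y0 by rewrite mdist_gt0.
have m0R : 0 < m%:R :> R by rewrite ltr0n.
have [x xA small] := small_ball x0A y0A xy.
(* [m] rings of width [s] exactly fill the radius of [small_ball]. *)
pose s := mdist x0 y0 / (4 * m%:R).
have s0 : 0 < s by rewrite divr_gt0 // mulr_gt0.
pose B i := [set z in A | mdist x z <= s * i%:R].
have sub i : B i \subset A by apply/fintype.subsetP => z; rewrite !inE => /andP[].
have xB i : x \in B i by rewrite inE xA mdistxx mulr_ge0 // ltW.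
have N0 : 0 < #|A|%:R :> R by rewrite ltr0n; apply/card_gt0P; exists x.
have Bm : (2 * #|B m| <= #|A|)%N.
  suff -> : B m = [set z in A | mdist x z <= mdist x0 y0 / 4] by [].
  apply/finset.setP => z; rewrite !inE; congr (_ && (_ <= _)).
  by rewrite /s; field; rewrite ?gt_eqF.
have Bmono i : (i <= m)%N -> (#|B i| <= #|B m|)%N.
  move=> im; apply: subset_leq_card; apply/fintype.subsetP => z; rewrite !inE => /andP[-> /=].
  by move/le_trans; apply; rewrite ler_pM2l // ler_nat.
apply: contrapT => /forallNP none.
have step i : (i < m)%N ->
    #|B i|%:R / #|A|%:R < (#|B i.+1|%:R / #|A|%:R) `^ beta :> R.
  move=> im; apply: powR_split => //.
    by rewrite ler0n ler_nat subset_leq_card.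
  rewrite ltNge; apply/negP => H; apply: (none (B i)); exists (A :\: B i.+1).
  split.
  - exact: sub.
  - exact: finset.subsetDl.
  - by apply/card_gt0P; exists x.
  (* The outer part is nonempty: [B i.+1] has no more points than [B m], hence at most half of
     [A]. *)
  - rewrite cardsD (finset.setIidPr (sub _)) subn_gt0.
    have := Bmono i.+1 im; have : (0 < #|A|)%N by rewrite -(ltr0n R).
    by move: Bm; clear; lia.
  - split.
      move=> u v; rewrite !inE => /andP[uA xu] /andP[+ vA].
      rewrite vA /= -ltNge => xv; rewrite -/s.
      have := metric_triangle x u v; move: xv; rewrite -(natr1 i) mulrDr mulr1; lra.
    by rewrite cardsD (finset.setIidPr (sub _)) natrB ?subset_leq_card.
have q0 i : 0 <= #|B i|%:R / #|A|%:R :> R by rewrite divr_ge0.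
have chain i : (i < m)%N ->
    #|B 0|%:R / #|A|%:R < (#|B i.+1|%:R / #|A|%:R) `^ (beta ^+ i.+1) :> R.
  elim: i => [/step|i IH im]; first by rewrite expr1.
  apply: lt_trans (IH (ltnW im)) _; rewrite [_ ^+ i.+2]exprS powRrM.
  by apply: gt0_ltr_powR; rewrite ?exprn_gt0 ?nnegrE ?powR_ge0 //; apply: step.
(* At the last radius the chain puts the density of [B 0] below (1/2)^(beta^m), hence below 1/|A|,
   although [B 0] contains [x]. *)
have := chain m.-1; rewrite prednK // leqnn => /(_ isT).
rewrite ltNge => /negP; apply.
have half : #|B m|%:R / #|A|%:R <= 2^-1 :> R.
  by rewrite ler_pdivrMr // mulrC ler_pdivlMr // mulrC -natrM ler_nat.
apply: (@le_trans _ _ (2^-1 `^ (beta ^+ m))).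
  by apply: ge0_ler_powR; rewrite ?nnegrE ?invr_ge0 // exprn_ge0 // ltW.
apply: (@le_trans _ _ (#|A|%:R^-1)).
  have -> : 2^-1 `^ (beta ^+ m) = (2 `^ (beta ^+ m))^-1 :> R.
    by rewrite -(@powR_inv1 _ 2) // -powRrM mulN1r powRN.
  by rewrite lef_pV2 // posrE powR_gt0.
rewrite -[leLHS]mul1r ler_pM2r ?invr_gt0 // ler1n.
by apply/card_gt0P; exists x.
Qed.
End Split.

(** Bernoulli's inequality makes l^n unbounded. The least n with y < l^n is positive since 1 <= y,
    and its predecessor is the exponent sought. *)
Lemma exists_scale (R : realType) (l y : R) : 1 < l -> 1 <= y ->
  exists i : nat, l ^+ i <= y < l ^+ i.+1.
Proof.
move=> l1 y1.
have bernoulli n : n%:R * (l - 1) < l ^+ n.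
  elim: n => [|n IH]; first by rewrite mul0r expr0.
  rewrite exprS -natr1 mulrDl mul1r.
  have : 1 <= l ^+ n by rewrite exprn_ege1 // ltW.
  nra.
have yl : exists n, y < l ^+ n.
  exists (Num.truncn (y / (l - 1))).+1; apply: le_lt_trans (bernoulli _).
  by rewrite -ler_pdivrMr ?subr_gt0 // ltW // truncnS_gt.
case: (ex_minnP yl) => -[|n] ny min; first by rewrite expr0 ltNge y1 in ny.
by exists n; rewrite ny andbT leNgt; apply/negP => /min; rewrite ltnn.
Qed.

(** * Joining two trees under a common root *)

Section Join.
Context (R : realType) (M : finMetricType R) (k alpha : R).
Local Notation tree := (ltree R M).
Local Notation good := (@good R M k alpha).
Local Notation apart := (@apart R M alpha).
Implicit Types (t u c : tree) (cs : seq tree) (D : R).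

(* A child whose label is already D is merged into the new root. *)
Definition children_below D t : seq tree :=
  match t with
  | Leaf _ => [:: t]
  | Node D' cs => if D' == D then cs else [:: t]
  end.

Definition join D t u : tree := Node D (children_below D t ++ children_below D u).

Lemma leaves_children_below D t :
  flatten [seq leaves c | c <- children_below D t] = leaves t.
Proof. by case: t => [x|D' cs] //=; case: ifP => //= _; rewrite cats0. Qed.

Lemma leaves_join D t u : leaves (join D t u) = leaves t ++ leaves u.
Proof. by rewrite leaves_node map_cat flatten_cat !leaves_children_below. Qed.

(** If [t] has label [D], its children inherit the conditions from [good t]; otherwise [t] itself is
    the only child. *)
Lemma good_children_below D t : good t -> label t = D \/ label t <= D / k -> 0 < D ->
  [/\ (0 < size (children_below D t))%N,
      all (fun c => label c <= D / k) (children_below D t),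
      pairwise (apart D) (children_below D t) & all good (children_below D t)].
Proof.
case: t => [x _ [<-|lk]|D' cs gN lD D0] /=; first by rewrite ltxx.
  by move=> _; rewrite lk.
case: (eqVneq D' D) => [ED|DD] /=.
  by move: gN; rewrite good_node ED => /and5P[].
by case: lD => /= lD; [rewrite lD eqxx in DD | rewrite lD gN].
Qed.

Lemma allrel_apart D cs cs' :
  {in flatten [seq leaves c | c <- cs] & flatten [seq leaves c | c <- cs'],
    forall x y, D <= mdist x y <= alpha * D} -> allrel (apart D) cs cs'.
Proof.
elim: cs => //= c cs IH H; rewrite allrel_consl IH; last first.
  by move=> x y xcs; apply: H; rewrite mem_cat xcs orbT.
rewrite andbT; elim: cs' {IH} H => //= c' cs' IH H; rewrite IH; last first.
  by move=> x y xc ycs; apply: H; rewrite // mem_cat ycs orbT.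
by rewrite andbT; apply/allrelP => x y xc yc'; apply: H; rewrite mem_cat ?xc ?yc'.
Qed.

Lemma good_join D t u : 0 < D -> good t -> good u ->
  label t = D \/ label t <= D / k -> label u = D \/ label u <= D / k ->
  {in leaves t & leaves u, forall x y, D <= mdist x y <= alpha * D} ->
  good (join D t u).
Proof.
move=> D0 gt gu lt lu tu; rewrite good_node D0 size_cat !all_cat pairwise_cat.
have [st lkt -> ->] := good_children_below gt lt D0.
have [_ -> -> ->] := good_children_below gu lu D0.
rewrite lkt addn_gt0 st !andbT /=; apply: allrel_apart.
by rewrite !leaves_children_below.
Qed.
End Join.

(** Distribute the factor a j0 + b j0 and bound every other factor by the maximum. *)
Lemma prod_join (c : nat) (a b : 'I_c -> nat) (j0 : 'I_c) :
  (\prod_j a j + \prod_j b j <=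
   \prod_j (if j == j0 then a j + b j else maxn (a j) (b j)))%N.
Proof.
rewrite (bigD1 j0) //= [X in (_ + X <= _)%N](bigD1 j0) //=.
rewrite [leqRHS](bigD1 j0) //= eqxx mulnDl.
apply: leq_add; rewrite leq_mul2l; apply/orP; right; apply: leq_prod => j /negPf ->.
  exact: leq_maxl.
exact: leq_maxr.
Qed.

(** * One tree for each residue class of scale exponents *)

(** The separation D/(4m) of [split_set], with the diameter D rounded down to delta * l^s. *)
Definition scale_label (R : realType) (delta l : R) (m s : nat) : R :=
  delta * l ^+ s / (4 * m%:R).

(** The bound s <= i ties the label to the diameter of the underlying set; the alternative 0 is for
    a single leaf. *)
Definition residue_label (R : realType) (M : finMetricType R) (L : nat -> R)
    (c : nat) (j : 'I_c) (i : nat) (t : ltree R M) : Prop :=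
  label t = 0 \/ exists s, [/\ (s <= i)%N, (s %% c = j)%N & label t = L s].

Section Residues.
Context (R : realType) (M : finMetricType R).
Variables (k alpha beta l delta : R) (c m : nat).
Hypotheses (beta1 : 1 < beta) (k1 : 1 < k) (l1 : 1 < l) (delta0 : 0 < delta).
Hypotheses (c0 : (0 < c)%N) (m0 : (0 < m)%N).
Hypotheses (k_le : k <= l ^+ c) (alpha_ge : 4 * m%:R * l <= alpha).
Hypothesis (delta_le : forall x y : M, x != y -> delta <= mdist x y).
Hypothesis (card_le : #|M|%:R <= 2 `^ (beta ^+ m)).

Local Notation L := (scale_label delta l m).
Local Notation residue_label := (@residue_label R M L c).

Let L_gt0 s : 0 < L s.
Proof. by rewrite divr_gt0 ?mulr_gt0 ?exprn_gt0 ?ltr0n // (lt_trans ltr01). Qed.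

Let L_le s s' : (s + c <= s')%N -> L s <= L s' / k.
Proof.
move=> ss'; have k0 : 0 < k := lt_trans ltr01 k1.
rewrite ler_pdivlMr // /scale_label mulrAC ler_pM2r; last first.
  by rewrite invr_gt0 mulr_gt0 // ltr0n.
rewrite -mulrA ler_pM2l //; apply: (@le_trans _ _ (l ^+ (s + c))).
  by rewrite exprD ler_pM2l // exprn_gt0 // (lt_trans ltr01).
by rewrite ler_eXn2l.
Qed.

(** Distinct exponents in one residue class modulo [c] differ by at least [c], and l^c >= k. *)
Let residue_label_join (j : 'I_c) (i : nat) (t : ltree R M) :
  residue_label j i t -> (i %% c = j)%N -> label t = L i \/ label t <= L i / k.
Proof.
move=> [->|[s [si sj ->]]] ij.
  by right; rewrite divr_ge0 ?ltW ?L_gt0 // (lt_trans ltr01).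
move: si; rewrite leq_eqVlt => /orP[/eqP->|si]; [by left | right].
apply: L_le; rewrite (divn_eq s c) (divn_eq i c) sj ij.
have : (s %/ c < i %/ c)%N.
  rewrite ltnNge; apply/negP => ii; move: si.
  by rewrite ltnNge (divn_eq s c) (divn_eq i c) sj ij leq_add2r leq_mul2r ii orbT.
move: (s %/ c)%N (i %/ c)%N (nat_of_ord j) c0; clear; nia.
Qed.

(** Strong induction on |A|. The exponent [i] bounds the diameter from above; the exact exponent
    [i0] labels the new root and is handed to both parts as their bound. *)
Lemma residue_trees (A : {set M}) (i : nat) : (0 < #|A|)%N ->
  {in A &, forall x y, mdist x y < delta * l ^+ i.+1} ->
  exists T : 'I_c -> ltree R M,
    #|A|%:R `^ beta^-1 <= (\prod_j size (leaves (T j)))%:R /\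
    forall j, [/\ good k alpha (T j), {subset leaves (T j) <= A} &
                  residue_label j i (T j)].
Proof.
have [n] := ubnP #|A|; elim: n A i => // n IH A i; rewrite ltnS => An A0 Ai.
have [x xA] := card_gt0P A0.
have [A1|A2] := leqP #|A| 1.
  exists (fun=> Leaf x); rewrite big1 //; split.
    by have -> : #|A| = 1%N by [apply/eqP; rewrite eqn_leq A1]; rewrite powR1.
  by move=> j; split=> //; [move=> y; rewrite inE => /eqP-> | left].
pose P (p : M * M) := (p.1 \in A) && (p.2 \in A).
have Px : P (x, x) by rewrite /P /= xA.
have [[x0 y0] /andP[/= x0A y0A] maxD] := arg_maxP (fun p : M * M => mdist p.1 p.2) Px.
have {}maxD u v : u \in A -> v \in A -> mdist u v <= mdist x0 y0.
  by move=> uA vA; apply: (maxD (u, v)); rewrite /P /= uA.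
have xy0 : x0 != y0.
  have [u [v [uA vA]]] : exists u v, [/\ u \in A, v \in A & u != v].
    by have /card_gt1P[u [v [uA vA uv]]] := A2; exists u, v.
  rewrite -!mdist_gt0 => uv; apply: lt_le_trans (maxD _ _ uA vA); exact: uv.
have [i0 /andP[lei0 lti0]] : exists i0 : nat, l ^+ i0 <= mdist x0 y0 / delta < l ^+ i0.+1.
  by apply: exists_scale => //; rewrite ler_pdivlMr // mul1r delta_le.
move: lei0 lti0; rewrite ler_pdivlMr // ltr_pdivrMr // ![_ * delta]mulrC => lei0 lti0.
have i0i : (i0 <= i)%N.
  rewrite -ltnS -(ltr_eXn2l l1) -(ltr_pM2l delta0).
  exact: le_lt_trans lei0 (Ai _ _ x0A y0A).
have Am : #|A|%:R <= 2 `^ (beta ^+ m).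
  by apply: le_trans card_le; rewrite ler_nat max_card.
have [U [W [UA WA U0 W0 [UWd AUW]]]] := split_set x0A y0A xy0 beta1 m0 Am.
have m0R : 0 < m%:R :> R by rewrite ltr0n.
have LD : L i0 <= mdist x0 y0 / (4 * m%:R).
  by rewrite ler_pM2r // invr_gt0 mulr_gt0.
have disj u : u \in U -> u \notin W.
  move=> uI; apply/negP => /(UWd _ _ uI); rewrite mdistxx leNgt => /negP; apply.
  exact: lt_le_trans (L_gt0 i0) LD.
have UltA : (#|U| < #|A|)%N.
  have [v vO] := card_gt0P W0; apply: proper_card.
  rewrite fintype.properE UA; apply/fintype.subsetPn; exists v; first exact: (fintype.subsetP WA).
  by apply/negP => /disj; rewrite vO.
have WltA : (#|W| < #|A|)%N.
  have [v vI] := card_gt0P U0; apply: proper_card.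
  rewrite fintype.properE WA; apply/fintype.subsetPn; exists v; first exact: (fintype.subsetP UA).
  exact: disj.
have bnd (B : {set M}) : B \subset A -> {in B &, forall u v, mdist u v < delta * l ^+ i0.+1}.
  move=> /fintype.subsetP BA u v uB vB.
  exact: le_lt_trans (maxD _ _ (BA _ uB) (BA _ vB)) lti0.
have [TI [TIp TIg]] := IH U i0 (leq_trans UltA An) U0 (bnd _ UA).
have [TO [TOp TOg]] := IH W i0 (leq_trans WltA An) W0 (bnd _ WA).
have j0P : (i0 %% c < c)%N by rewrite ltn_pmod.
pose j0 := Ordinal j0P.
pose T j := if j == j0 then join (L i0) (TI j) (TO j) else
  if (size (leaves (TI j)) <= size (leaves (TO j)))%N then TO j else TI j.
exists T; split.
  apply: le_trans AUW _; apply: le_trans (lerD TIp TOp) _.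
  rewrite -natrD ler_nat; apply: leq_trans (prod_join _ _ j0) _.
  apply: leq_prod => j _; rewrite /T; case: eqP => [_|_].
    by rewrite leaves_join size_cat.
  by case: (leqP (size (leaves (TI j))) (size (leaves (TO j)))).
have widen j t : residue_label j i0 t -> residue_label j i t.
  move=> [t0|[s [si sj ts]]]; first by left.
  by right; exists s; split=> //; apply: leq_trans si i0i.
have UsubA := fintype.subsetP UA; have WsubA := fintype.subsetP WA.
move=> j; have [gI sI rI] := TIg j; have [gO sO rO] := TOg j; rewrite /T.
case: eqP => [jj0|_]; last first.
  case: ifP => _; split; [by []|by move=> u /sO /WsubA|exact: widen|
    by []|by move=> u /sI /UsubA|exact: widen].
have ij : (i0 %% c = j)%N by rewrite jj0.
split.
- apply: good_join => //; first exact: residue_label_join rI ij.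
    exact: residue_label_join rO ij.
  move=> u v /sI uI /sO vO; rewrite (le_trans LD (UWd _ _ uI vO)) /=.
  (* The factor 4 m makes up for the separation and [l] for the rounding: the product is delta *
     l^(i0+1), which exceeds the diameter of [A]. *)
  apply: (@le_trans _ _ (4 * m%:R * l * L i0)); last by rewrite ler_pM2r.
  apply: ltW; apply: le_lt_trans (maxD _ _ (UsubA _ uI) (WsubA _ vO)) _.
  suff -> : 4 * m%:R * l * L i0 = delta * l ^+ i0.+1 by [].
  by rewrite /scale_label exprS; field; rewrite gt_eqF.
- by move=> u; rewrite leaves_join mem_cat => /orP[/sI/UsubA|/sO/WsubA].
- by right; exists i0.
Qed.

Lemma exists_good_tree : (0 < #|M|)%N -> exists t : ltree R M,
  good k alpha t /\ #|M|%:R `^ beta^-1 <= (size (leaves t))%:R ^+ c.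
Proof.
move=> M0; pose A := [set x : M | true]%SET.
have AM : #|A| = #|M| by apply: eq_card => x; rewrite inE.
(* The summand 1 brings [y] into the range of [exists_scale]; the sum dominates every single
   distance. *)
pose y := 1 + (\sum_(p : M * M) mdist p.1 p.2) / delta.
have S0 : 0 <= \sum_(p : M * M) mdist p.1 p.2 by apply: sumr_ge0 => p _; apply: mdist_ge0.
have [i /andP[_ yi]] : exists i : nat, l ^+ i <= y < l ^+ i.+1.
  by apply: exists_scale => //; rewrite lerDl divr_ge0 // ltW.
have [||T [TA Tg]] := @residue_trees A i; first by rewrite AM.
  move=> u v _ _; rewrite mulrC -ltr_pdivrMr //; apply: le_lt_trans yi.
  rewrite /y (bigD1 (u, v)) //= mulrDl addrCA lerDl addr_ge0 // divr_ge0 ?(ltW delta0) //.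
  by apply: sumr_ge0 => p _; apply: mdist_ge0.
(* The largest of the [c] leaf counts, raised to the power [c], is at least their product. *)
have [j _ jmax] := arg_maxnP (fun j => size (leaves (T j))) (erefl (xpredT (Ordinal c0))).
exists (T j); split; first by case: (Tg j).
move: TA; rewrite AM => /le_trans; apply; rewrite -natrX ler_nat.
apply: (@leq_trans (\prod_(j' < c) size (leaves (T j)))).
  by apply: leq_prod => j' _; apply: jmax.
by rewrite prod_nat_const card_ord.
Qed.
End Residues.

(** * Choice of parameters and the final bound *)

(** A minimum over finitely many pairs, capped at 1, which is also its value when no two points
    differ. *)
Lemma card_metric_gap (R : realType) (M : finMetricType R) :
  exists2 delta : R, 0 < delta & forall x y : M, x != y -> delta <= mdist x y.
Proof.
exists (\big[Order.min/1]_(p : M * M | p.1 != p.2) mdist p.1 p.2).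
  by elim/big_ind: _ => // [x y x0 y0|p]; rewrite ?lt_min ?x0 // mdist_gt0.
by move=> x y xy; apply: (bigmin_le_cond 1 (fun p : M * M => mdist p.1 p.2) (j := (x, y))).
Qed.

Lemma tree_hst (R : realType) (M : finMetricType R) (k alpha : R) (t : ltree R M) :
  good k alpha t -> binary_balanced t -> exists2 S : {set M}, #|S| = size (leaves t) &
  exists d', binary_balanced_hst k S d' /\ approximates S alpha (@mdist R M) d'.
Proof.
move=> gt bt; exists [set x in leaves t]%SET.
  by rewrite cardsE; apply/card_uniqP; apply: good_uniq gt.
exists (fun x y => label (lca t x y)); split.
  exists t; split=> //; split=> //; [by case/andP: gt|exact: good_uniq gt|].
  by move=> x; rewrite inE.
by move=> x y; rewrite !inE => xt yt; apply: (lca_bounds gt).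
Qed.

Theorem theorem7p4 (R : realType) :
  exists C : R, 0 < C /\
  forall (M : finMetricType R) (n : nat) (beta k l : R),
    #|M| = n -> (0 < n)%N ->
    1 < beta -> 1 < k -> 1 < l -> l <= k ->
    exists S : {set M},
      n%:R `^ (1 / (2 * beta * (Num.ceil (logb l k))%:~R)) <= #|S|%:R /\
      exists d' : M -> M -> R,
        binary_balanced_hst k S d' /\
        approximates S (approx_factor C beta l n) (@mdist R M) d'.
Proof.
(* The trees cost a factor 4 m l, and m <= 2 log_beta log_2 n turns 4 into 8. *)
exists 8; split=> // M n beta k l Mn n0 beta1 k1 l1 lk.
set f := approx_factor _ _ _ _.
have f1 : 1 <= f by rewrite le_max lexx.
have lnl : 0 < ln l by rewrite ln_gt0.
have logb1 : 1 <= logb l k.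
  by rewrite ler_pdivlMr // mul1r ler_ln // posrE (lt_trans ltr01).
have [c [cE c0]] : exists c : nat, Num.ceil (logb l k) = c%:Z /\ (0 < c)%N.
  have : 1 <= Num.ceil (logb l k).
    by rewrite -(@ler_int R); apply: le_trans logb1 (ceil_ge _).
  by case: (Num.ceil _) => // c c1; exists c.
rewrite cE -[c%:~R]/(c%:R); set e := 1 / _.
have k_le : k <= l ^+ c.
  have -> : k = l `^ logb l k.
    rewrite /powR gt_eqF ?(lt_trans ltr01) // divfK ?gt_eqF //.
    by rewrite lnK // posrE (lt_trans ltr01).
  rewrite -powR_mulrn ?(le_trans ler01 (ltW l1)) //; apply: ler_powR; first exact: ltW.
  by have := ceil_ge (logb l k); rewrite cE.
suff [t [gt bt nt]] : exists t : ltree R M, [/\ good k f t, binary_balanced t &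
    n%:R `^ e <= (size (leaves t))%:R].
  have [S Sn dS] := tree_hst gt bt; exists S; rewrite Sn; by split.
have [x _] : exists x : M, x \in M by apply/card_gt0P; rewrite Mn.
have c0R : 1 <= c%:R :> R by rewrite ler1n.
have e0 : 0 < e by rewrite divr_gt0 // !mulr_gt0 ?(lt_trans ltr01 beta1) ?ltr0n.
have [n1|n2] := leqP n 1.
  exists (Leaf x); split=> //.
  by have -> : n = 1%N by [apply/eqP; rewrite eqn_leq n1]; rewrite powR1.
(* In the small case a two-leaf tree labelled by the distance is exact, and [f1] admits it. *)
have [small|large] := leP (n%:R `^ e) 2.
  have [u [v [_ _ uv]]] : exists u v : M, [/\ u \in M, v \in M & u != v].
    by apply/card_gt1P; rewrite Mn.
  have D0 : 0 < mdist u v by rewrite mdist_gt0.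
  exists (Node (mdist u v) [:: Leaf u; Leaf v]); split=> //.
    rewrite good_node D0 /= divr_ge0 ?mdist_ge0 ?(ltW (lt_trans ltr01 k1)) //=.
    by rewrite /apart /allrel /= lexx ler_peMl // mdist_ge0.
have ln2 : 0 < ln (2 : R) by rewrite ln_gt0 // ltr1n.
have lnb : 0 < ln beta by rewrite ln_gt0.
have n0R : 0 < n%:R :> R by rewrite ltr0n.
(* n^e > 2 means log_2 n > 2 beta c, which exceeds beta since c >= 1; hence z > 1 below. *)
have ybeta : beta < logb 2 n%:R.
  rewrite ltr_pdivlMr //.
  have : ln 2 < ln (n%:R `^ e) by rewrite ltr_ln ?posrE ?powR_gt0 ?ltr0n.
  rewrite ln_powR /e mulrAC mul1r ltr_pdivlMr; last first.
    by rewrite !mulr_gt0 ?(lt_trans ltr01 beta1) ?ltr0n.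
  apply: le_lt_trans; rewrite mulrC ler_pM2l //.
  by nra.
set y := logb 2 n%:R in ybeta *.
have y0 : 0 < y by apply: lt_trans ybeta; apply: lt_trans beta1.
have z1 : 1 < logb beta y by rewrite ltr_pdivlMr // mul1r ltr_ln // posrE (lt_trans ltr01).
set z := logb beta y in z1.
(* This [m] exceeds z, so beta^m >= log_2 n, and z > 1 keeps it at most 2 z. *)
pose m := (Num.truncn z).+1.
have zm : z < m%:R by apply: truncnS_gt.
have mz : m%:R <= 2 * z.
  rewrite /m -natr1; have : (Num.truncn z)%:R <= z by rewrite truncn_le (ltW (lt_trans ltr01 z1)).
  by lra.
have [delta delta0 delta_le] := card_metric_gap M.
have n_le : #|M|%:R <= 2 `^ (beta ^+ m).
  rewrite Mn; have -> : n%:R = 2 `^ y :> R.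
    by rewrite /powR pnatr_eq0 /= divfK ?gt_eqF // lnK.
  apply: ler_powR; first by rewrite ler1n.
  have -> : y = beta `^ z.
    by rewrite /powR gt_eqF ?(lt_trans ltr01) // divfK ?gt_eqF // lnK.
  rewrite -powR_mulrn ?(le_trans ler01 (ltW beta1)) //; apply: ler_powR; exact: ltW.
have f_ge : 4 * m%:R * l <= f.
  rewrite le_max; apply/orP; right; rewrite -/y -/z; nra.
have M0 : (0 < #|M|)%N by rewrite Mn.
have [t [gt nt]] := exists_good_tree beta1 k1 l1 delta0 c0 (ltn0Sn _ : (0 < m)%N)
  k_le f_ge delta_le n_le M0.
have [t' [[gt' _ _] bt' tt']] := prune_binary_balanced gt.
exists t'; split=> //.
(* Pruning keeps at least the square root of the leaf count, hence 2 c in place of c. *)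
have -> : e = beta^-1 * (2 * c)%:R^-1.
  by rewrite /e mul1r natrM !invfM; ring.
rewrite powRrM -Mn.
apply: (@le_trans _ _ ((((size (leaves t'))%:R ^+ (2 * c)) `^ (2 * c)%:R^-1) : R)).
  apply: ge0_ler_powR; rewrite ?nnegrE ?powR_ge0 ?exprn_ge0 ?invr_ge0 //.
  by apply: le_trans nt _; rewrite exprM -!natrX ler_nat leq_exp2r.
rewrite -powR_mulrn // -powRrM divff ?powRr1 // pnatr_eq0 muln_eq0 /= -lt0n.
by rewrite c0.
Qed.
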